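(* Let $u,v\in\mathcal{M}_d$ with $u\geq_{lex}v$ and let $I=(L(u,v))$ be a lexsegment ideal which is neither initial nor final, with $x_1\nmid v$, and such that $\operatorname{depth}(S/I)=0$. Then $$\operatorname{Ass}(S/I)=\{(x_1,\ldots,x_j) : j\in \operatorname{supp}(v)\cup\{n\}\}\cup\{(x_2,\ldots,x_n)\}.$$
   Context: $K$ is a field, $S=K[x_1,\ldots,x_n]$, and monomials of $S$ are ordered by the lexicographical order $\geq_{lex}$ induced by $x_1>x_2>\cdots>x_n$. Let $d\geq 2$ be an integer and $\mathcal{M}_d$ the set of monomials of degree $d$ of $S$. For $u,v\in\mathcal{M}_d$ with $u\geq_{lex}v$, $L(u,v)=\{w\in\mathcal{M}_d : u\geq_{lex}w\geq_{lex}v\}$ is a lexsegment set, and the ideal $(L(u,v))$ it generates is a lexsegment ideal. It is called initial if it is of the form $(L(x_1^d,v))$, and final if it is of the form $(L(u,x_n^d))$. For a monomial $w$, $\operatorname{supp}(w)=\{i : x_i\mid w\}$. *)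

(* Defs.v *)
From HB Require Import structures.
From mathcomp Require Import all_boot all_order all_algebra.
From mathcomp Require Import mpoly.

Set Implicit Arguments.
Unset Strict Implicit.
Unset Printing Implicit Defensive.

Import Order.TTheory GRing.Theory.

Local Open Scope ring_scope.

(* Ideals are Prop-valued predicates, compared extensionally: membership in an
   arbitrary ideal or in an arbitrary prime is not given by a boolean. *)

Definition same_ideal (R : comNzRingType) (I J : R -> Prop) : Prop :=
  forall f, I f <-> J f.

Definition gen_ideal (R : comNzRingType) (G : R -> Prop) (f : R) : Prop :=
  exists s : seq (R * R),
    (forall p, p \in s -> G p.2) /\ f = \sum_(p <- s) p.1 * p.2.

Definition is_ideal (R : comNzRingType) (I : R -> Prop) : Prop :=
  [/\ I 0, forall f g, I f -> I g -> I (f + g)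
    & forall a f, I f -> I (a * f)].

Definition is_prime_ideal (R : comNzRingType) (P : R -> Prop) : Prop :=
  [/\ is_ideal P, ~ P 1 & forall f g, P (f * g) -> P f \/ P g].

Definition ideal_add (R : comNzRingType) (I J : R -> Prop) (f : R) : Prop :=
  exists g h, [/\ I g, J h & f = g + h].

(* Ass(R/I): the primes that are the annihilator {g | g f \in I} of the class
   of some f in R/I. *)
Definition Ass_quot (R : comNzRingType) (I P : R -> Prop) : Prop :=
  is_prime_ideal P /\ exists f, forall g, P g <-> I (g * f).

(* fs = [:: f_0; ...; f_(r-1)] is an (R/I)-regular sequence: each f_i is a
   nonzerodivisor on R/(I + (f_0, ..., f_(i-1))), and
   R/(I + (f_0, ..., f_(r-1))) is nonzero. *)
Definition regular_seq_quot (R : comNzRingType) (I : R -> Prop) (fs : seq R) :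
    Prop :=
  (forall i, (i < size fs)%N -> forall g,
     let J := ideal_add I (gen_ideal (fun f => f \in take i fs)) in
     J (fs`_i * g) -> J g)
  /\ ~ ideal_add I (gen_ideal (fun f => f \in fs)) 1.

Definition var_ideal (K : fieldType) (n : nat) (A : pred 'I_n) :
    {mpoly K[n]} -> Prop :=
  gen_ideal (fun f => exists2 i, A i & f = 'X_i).

(* depth(S/I) for S = K[x_1, ..., x_n]: the maximal length of an
   (S/I)-regular sequence contained in (x_1, ..., x_n). *)
Definition is_depth_quot (K : fieldType) (n : nat) (I : {mpoly K[n]} -> Prop)
    (k : nat) : Prop :=
  let reg_in_max (fs : seq {mpoly K[n]}) :=
    (forall f, f \in fs -> var_ideal predT f) /\ regular_seq_quot I fs in
  (exists2 fs, reg_in_max fs & size fs = k)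
  /\ (forall fs, reg_in_max fs -> (size fs <= k)%N).

(* Pure lexicographic comparison of exponent vectors with x_1 > ... > x_n: the
   variable x_i is 'X_j with j : 'I_n of value i - 1. *)
Definition lex_ge (n : nat) (u v : 'X_{1..n}) : bool :=
  ((multinom_val v : seqlexi nat) <= (multinom_val u : seqlexi nat))%O.

Definition lexsegment (n d : nat) (u v w : 'X_{1..n}) : bool :=
  [&& mdeg w == d, lex_ge u w & lex_ge w v].

Definition lexseg_ideal (K : fieldType) (n d : nat) (u v : 'X_{1..n}) :
    {mpoly K[n]} -> Prop :=
  gen_ideal (fun f => exists2 w, lexsegment d u v w & f = 'X_[w]).

Arguments lexseg_ideal K {n} d u v _.

Definition initial_lexseg (K : fieldType) (n d : nat)
    (I : {mpoly K[n.+1]} -> Prop) : Prop :=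
  exists v : 'X_{1..n.+1},
    mdeg v = d /\ same_ideal I (lexseg_ideal K d (U_(ord0) *+ d)%MM v).

Definition final_lexseg (K : fieldType) (n d : nat)
    (I : {mpoly K[n.+1]} -> Prop) : Prop :=
  exists u : 'X_{1..n.+1},
    mdeg u = d /\ same_ideal I (lexseg_ideal K d u (U_(ord_max) *+ d)%MM).

Definition mnm_supp (n : nat) (w : 'X_{1..n}) : {set 'I_n} :=
  [set i | (U_(i) <= w)%MM].

(* Main.v *)
Require Import Defs.
From mathcomp Require Import all_boot all_order all_algebra.
From mathcomp Require Import mpoly.
From mathcomp Require Import zify ring.
From Stdlib Require Import Classical.

Set Implicit Arguments.
Unset Strict Implicit.
Unset Printing Implicit Defensive.

Import Order.TTheory GRing.Theory.

Local Open Scope ring_scope.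

(** Write x_0, ..., x_n for the variables and I for the lexsegment ideal of
    [u, v]. The proof has an algebraic half, valid for every monomial ideal I,
    and a combinatorial half about the lexicographic order.

    Algebra. If f is not in I, some monomial multiple h of f is outside I and
    is [stable]: a monomial m that sends one surviving term of h into I sends
    all of h into I. For a stable h, comparing leading terms shows that g h
    in I forces m h in I for every monomial m of g ([stable_colon]). Applied to
    h with (I : h) prime, this shows that an associated prime is generated by
    variables and equals (I : w) for a monomial w ([Ass_mono_idealP]). Applied
    to g = x_0 + ... + x_n, it shows that either this sum is regular modulo I
    or I has a socle monomial: some w outside I with x_i w in I for all i
    ([depth0_socle]). So depth 0 yields a socle monomial, and the theorem
    becomes the question which sets A of variables satisfy (I : w) = (A) for
    some monomial w, written [colon_is w A].

    Combinatorics. A socle monomial forces x_0 | u and the key inequality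
    x_n u >= x_0 v ([socle_lex_ge]). As x_0 divides u but not v, a monomial of
    degree d lies in the segment as soon as it is free of x_0 and at least v,
    or divisible by x_0 and at most u. Hence:

    - for j in the support of v, j < n, the monomial (v / x_j) x_n^(d-1) has
      colon ideal (x_0, ..., x_j) ([colon_supp]);
    - with a the exponent of x_0 in u, a < d because I is not initial, either
      x_0^a x_1^(d-a) or x_0^a x_1^(d-a-1) has colon ideal (x_1, ..., x_n)
      ([colon_no0]);
    - the socle monomial has colon ideal (x_0, ..., x_n);
    - nothing else occurs ([colon_cases]). If x_0 is not in A, then A contains
      every other variable because x_0 x_j^d is in I. If x_0 and x_n are in A,
      then w is a socle monomial. If x_0 is in A but x_n is not, then w, even
      when multiplied by powers of x_n, stays out of I, so w drops below v at
      a first position j < n, and A is {x_0, ..., x_j}. *)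

(** * Ideals given by generators *)

Lemma gen_ideal_is_ideal (R : comNzRingType) (G : R -> Prop) :
  is_ideal (gen_ideal G).
Proof.
split.
- by exists [::]; rewrite big_nil.
- move=> f g [s [Gs ->]] [t [Gt ->]]; exists (s ++ t); rewrite big_cat.
  by split=> // p; rewrite mem_cat => /orP[/Gs|/Gt].
- move=> a f [s [Gs ->]]; exists [seq (a * p.1, p.2) | p <- s]; split.
    by move=> _ /mapP[p /Gs Gp ->].
  by rewrite big_map mulr_sumr; apply: eq_bigr => p _ /=; rewrite mulrA.
Qed.

Lemma gen_ideal_gen (R : comNzRingType) (G : R -> Prop) f :
  G f -> gen_ideal G f.
Proof.
move=> Gf; exists [:: (1, f)]; rewrite big_seq1 mul1r; split=> // p.
by rewrite inE => /eqP->.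
Qed.

Lemma is_ideal_sum (R : comNzRingType) (I : R -> Prop) (J : eqType) (s : seq J)
    (F : J -> R) :
  is_ideal I -> (forall j, j \in s -> I (F j)) -> I (\sum_(j <- s) F j).
Proof. by case=> I0 ID _ IF; rewrite big_seq; elim/big_ind: _. Qed.

(** * Monomial ideals

    A monomial ideal is represented by the boolean predicate [T] selecting its
    monomials. *)

Section MonomialIdeals.

Variables (K : fieldType) (n : nat) (T : pred 'X_{1..n}).
Hypothesis T_up : forall m k : 'X_{1..n}, T m -> T (m + k)%MM.

Implicit Types (f g : {mpoly K[n]}) (m w : 'X_{1..n}).

Definition mono_ideal f : Prop := forall m, m \in msupp f -> T m.

Lemma mono_ideal0 : mono_ideal 0.
Proof. by move=> m; rewrite msupp0. Qed.

Lemma mono_idealD f g : mono_ideal f -> mono_ideal g -> mono_ideal (f + g).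
Proof.
by move=> If Ig m /msuppD_le; rewrite mem_cat => /orP[/If|/Ig].
Qed.

Lemma mono_idealM f g : mono_ideal g -> mono_ideal (f * g).
Proof.
move=> Ig m /msuppM_le /allpairsP[[m1 m2] /= [_ /Ig Tm2 ->]].
by rewrite addmC; exact: T_up.
Qed.

Lemma mono_ideal_is_ideal : is_ideal mono_ideal.
Proof.
by split; [exact: mono_ideal0 | exact: mono_idealD | exact: mono_idealM].
Qed.

Lemma mono_idealN f : mono_ideal f -> mono_ideal (- f).
Proof. by rewrite -mulN1r; exact: mono_idealM. Qed.

Lemma mono_idealX m : mono_ideal 'X_[m] <-> T m.
Proof.
rewrite /mono_ideal msuppX; split; first by apply; rewrite inE.
by move=> Tm k; rewrite inE => /eqP->.
Qed.

Lemma mono_idealMX f m :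
  mono_ideal ('X_[m] * f) <-> (forall w, w \in msupp f -> T (m + w)%MM).
Proof.
rewrite mulrC /mono_ideal; split=> [Imf w wf|Imf w].
  by apply: Imf; rewrite (perm_mem (msuppMX _ _)) map_f.
by rewrite (perm_mem (msuppMX _ _)) => /mapP[k kf ->]; exact: Imf.
Qed.

Lemma gen_ideal_monomials (G : 'X_{1..n} -> Prop) :
    (forall m, T m <-> exists2 w, G w & (w <= m)%MM) ->
  same_ideal (gen_ideal (fun f => exists2 w, G w & f = 'X_[w])) mono_ideal.
Proof.
move=> TG f; split.
  case=> s [Gs ->]; apply: is_ideal_sum (mono_ideal_is_ideal) _ => p /Gs[w Gw ->].
  apply: mono_idealM; apply/mono_idealX/TG; exists w => //; exact: lepm_refl.
move=> If; rewrite [f]mpolyE; have [G0 GD GM] := gen_ideal_is_ideal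
  (fun f : {mpoly K[n]} => exists2 w, G w & f = 'X_[w]).
apply: is_ideal_sum; first by split.
move=> m /If /TG[w Gw /submK <-]; rewrite mpolyXD scalerAl.
by apply: GM; apply: gen_ideal_gen; exists w.
Qed.

(** The representative of f modulo the ideal none of whose terms lie in it.
    Leading-term arguments apply to it, whereas the leading term of f itself
    may lie in the ideal and carry no information. *)
Definition normal_part f : {mpoly K[n]} := \sum_(m <- msupp f | ~~ T m) f@_m *: 'X_[m].

Lemma msupp_normal_part f : perm_eq (msupp (normal_part f)) [seq m <- msupp f | ~~ T m].
Proof.
rewrite /normal_part -big_filter msupp_sumX ?filter_uniq //.
by move=> m; rewrite mem_filter mcoeff_msupp => /andP[].
Qed.

Lemma mem_normal_part f m : (m \in msupp (normal_part f)) = ~~ T m && (m \in msupp f).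
Proof. by rewrite (perm_mem (msupp_normal_part f)) mem_filter. Qed.

Lemma normal_part_congr f : mono_ideal (f - normal_part f).
Proof.
rewrite {1}[f]mpolyE (bigID (fun m => T m)) /= addrK -big_filter.
apply: is_ideal_sum mono_ideal_is_ideal _ => m; rewrite mem_filter => /andP[Tm _].
by rewrite -mul_mpolyC; apply: mono_idealM; apply/mono_idealX.
Qed.

Lemma normal_part_eq0 f : normal_part f = 0 -> mono_ideal f.
Proof. by move=> f0; have := @normal_part_congr f; rewrite f0 subr0. Qed.

(** If f and g are both outside the ideal, the product of the leading monomials
    of their normal parts is the leading monomial of a polynomial congruent to
    f g, and it is outside the ideal. So it suffices to test primality on
    monomials. *)
Lemma mono_ideal_prime :
    ~~ T 0%MM -> (forall m k, T (m + k)%MM -> T m || T k) ->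
  is_prime_ideal mono_ideal.
Proof.
move=> T0 TM; split; first exact: mono_ideal_is_ideal.
  by rewrite -mpolyX0 => /mono_idealX; apply/negP.
move=> f g Ifg; have [/normal_part_eq0|f0] := eqVneq (normal_part f) 0; first by left.
have [/normal_part_eq0|g0] := eqVneq (normal_part g) 0; first by right.
have : mono_ideal (normal_part f * normal_part g).
  have -> : normal_part f * normal_part g
      = f * g + (- ((f - normal_part f) * g) - normal_part f * (g - normal_part g)).
    by ring.
  apply: mono_idealD => //; apply: mono_idealD; apply: mono_idealN.
    by rewrite mulrC; apply: mono_idealM; exact: normal_part_congr.
  by apply: mono_idealM; exact: normal_part_congr.
move/(_ (mlead (normal_part f * normal_part g))); rewrite mlead_supp ?mulf_neq0 //.
move/(_ isT); rewrite mleadM // => /TM.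
have := mlead_supp f0; have := mlead_supp g0; rewrite !mem_normal_part.
by case/andP=> /negPf-> _ /andP[/negPf-> _].
Qed.

(** The class of a stable f modulo the ideal behaves like that of a single
    monomial: its annihilator is the colon ideal of any surviving term. *)
Definition stable f : Prop :=
  forall m w, w \in msupp f -> ~~ T w -> T (m + w)%MM -> mono_ideal ('X_[m] * f).

(** The leading monomial of g times that of the normal part of f is the leading
    monomial of a member of the ideal, so by stability the leading monomial of
    g kills f. Subtract the leading term of g and repeat. *)
Lemma stable_colon f g m :
  stable f -> mono_ideal (g * f) -> m \in msupp g -> mono_ideal ('X_[m] * f).
Proof.
move=> fS.
have [/normal_part_eq0 If _ _|f0] := eqVneq (normal_part f) 0; first exact: mono_idealM.
move: {2}(size (msupp g)) (leqnn (size (msupp g))) => k.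
elim: k g m => [|k IHk] g m; first by rewrite leqn0 => /nilP->.
move=> gk Igf mg.
have g0 : g != 0 by rewrite -msupp_eq0; case: (msupp g) mg.
have Ilead : mono_ideal ('X_[mlead g] * f).
  have := mlead_supp f0; rewrite mem_normal_part => /andP[nTw wf].
  apply: (fS _ _ wf nTw).
  have : mono_ideal (g * normal_part f).
    rewrite -[normal_part f](subKr f) mulrBr; apply: mono_idealD => //.
    by apply: mono_idealN; apply: mono_idealM; exact: normal_part_congr.
  by apply; rewrite -mleadM // mlead_supp // mulf_neq0.
have [->//|neq] := eqVneq m (mlead g).
have gp := msupp_rem g (mlead g).
apply: (IHk (g - g@_(mlead g) *: 'X_[mlead g])).
- by rewrite (perm_size gp) size_rem ?mlead_supp // -subn1 leq_subLR add1n.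
- rewrite mulrBl; apply: mono_idealD => //; apply: mono_idealN.
  by rewrite -scalerAl -mul_mpolyC; apply: mono_idealM.
- by rewrite (perm_mem gp) mem_rem_uniq ?msupp_uniq // inE neq.
Qed.

(** If m kills one surviving term of f but not all of f, then m f is outside
    the ideal and has fewer surviving terms than f; this can only happen
    finitely often. *)
Lemma exists_stable f :
  ~ mono_ideal f -> exists2 m, ~ mono_ideal ('X_[m] * f) & stable ('X_[m] * f).
Proof.
have [k] := ubnP (size (msupp (normal_part f))).
elim: k f => // k IHk f; rewrite ltnS => fk nIf.
have [fS|] := classic (stable f).
  by exists 0%MM; rewrite mpolyX0 mul1r.
move=> /not_all_ex_not[m /not_all_ex_not[w nS]].
have [wf [nTw [Tmw nImf]]] : w \in msupp f /\ ~~ T w /\ T (m + w)%MM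
    /\ ~ mono_ideal ('X_[m] * f) by tauto.
have [|//|k' ] := IHk ('X_[m] * f).
  apply: leq_trans fk; rewrite !(perm_size (msupp_normal_part _)) !size_filter mulrC.
  rewrite (permP (msuppMX _ _)) count_map.
  rewrite -!size_filter; set s := filter _ _; set t := filter _ _.
  (* w is a surviving term of f that is lost in m f, hence the strict inequality. *)
  suff : (size (w :: s) <= size t)%N by [].
  apply: uniq_leq_size.
    by rewrite /= filter_uniq ?msupp_uniq // mem_filter /= Tmw.
  move=> z; rewrite inE !mem_filter => /predU1P[->|]; first by rewrite nTw.
  move=> /andP[/= nTz ->]; rewrite andbT; apply: contra nTz => Tz.
  by rewrite addmC; exact: T_up.
by rewrite mulrA -mpolyXD => nI S; exists (k' + m)%MM.
Qed.

End MonomialIdeals.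

(** * Primes generated by variables, associated primes and depth *)

Definition meets (n : nat) (A : pred 'I_n) (m : 'X_{1..n}) : bool :=
  [exists i, A i && (m i != 0%N)].

Lemma meetsD (n : nat) (A : pred 'I_n) (m k : 'X_{1..n}) :
  meets A (m + k)%MM = meets A m || meets A k.
Proof.
apply/existsP/orP=> [[i /andP[Ai]]|].
  rewrite mnmDE addn_eq0 negb_and => /orP[mi|ki].
    by left; apply/existsP; exists i; rewrite Ai.
  by right; apply/existsP; exists i; rewrite Ai.
by case=> /existsP[i /andP[Ai mi]]; exists i; rewrite Ai mnmDE addn_eq0 negb_and
  mi ?orbT.
Qed.

Lemma meets0 (n : nat) (A : pred 'I_n) : ~~ meets A 0%MM.
Proof. by apply/existsP=> -[i]; rewrite mnm0E andbF. Qed.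

Lemma meetsU (n : nat) (A : pred 'I_n) i : meets A U_(i)%MM = A i.
Proof.
apply/existsP/idP=> [[j]|Ai]; last by exists i; rewrite Ai mnm1E eqxx.
by rewrite mnm1E; case: (i =P j) => [->|]; rewrite ?andbF // => /andP[].
Qed.

Lemma meets_up (n : nat) (A : pred 'I_n) (m k : 'X_{1..n}) :
  meets A m -> meets A (m + k)%MM.
Proof. by rewrite meetsD => ->. Qed.

Section AssociatedPrimes.

Variables (K : fieldType) (n : nat).

Implicit Types (I J P : {mpoly K[n]} -> Prop).

Lemma var_idealP (A : pred 'I_n) :
  same_ideal (@var_ideal K n A) (mono_ideal (meets A)).
Proof.
have E := @gen_ideal_monomials K n _ (@meets_up n A)
  (fun w => exists2 i, A i & w = U_(i)%MM).
move=> f; rewrite -E => [|m].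
  split=> -[s [Gs ->]]; exists s; split=> // p /Gs.
    by move=> [i Ai ->]; exists U_(i)%MM => //; exists i.
  by move=> [_ [i Ai ->] ->]; exists i.
split=> [/existsP[i /andP[Ai mi]]|[_ [i Ai ->]]].
  by exists U_(i)%MM; [exists i | rewrite lep1mP].
by rewrite lep1mP => mi; apply/existsP; exists i; rewrite Ai.
Qed.

Lemma same_ideal_prime P J :
  same_ideal P J -> is_prime_ideal J -> is_prime_ideal P.
Proof.
move=> PJ [[J0 JD JM] J1 JP]; split; first split.
- exact/PJ.
- by move=> f g /PJ Jf /PJ Jg; apply/PJ; exact: JD.
- by move=> a f /PJ Jf; apply/PJ; exact: JM.
- by move/PJ.
- by move=> f g /PJ/JP[/PJ|/PJ]; [left|right].
Qed.

Lemma var_ideal_prime (A : pred 'I_n) : is_prime_ideal (@var_ideal K n A).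
Proof.
apply: same_ideal_prime (var_idealP A) _; apply: mono_ideal_prime.
- exact: meets_up.
- exact: meets0.
- by move=> m k; rewrite meetsD.
Qed.

Lemma prime_monomial P (m : 'X_{1..n}) :
  is_prime_ideal P -> P 'X_[m] <-> exists2 i, m i != 0%N & P 'X_i.
Proof.
move=> [[P0 PD PM] P1 PP]; split; last first.
  move=> [i mi Pi]; rewrite -(@submK _ U_(i)%MM m) ?lep1mP // mpolyXD.
  exact: PM.
have [k] := ubnP (mdeg m); elim: k m => // k IHk m; rewrite ltnS => mk Pm.
have [i mi|m0] := pickP (fun i => m i != 0%N); last first.
  case: P1; rewrite -mpolyX0; suff <- : m = 0%MM by [].
  by apply/mnmP=> i; rewrite mnm0E; apply/eqP/negbFE/m0.
have mE : (m - U_(i) + U_(i) = m)%MM by rewrite submK ?lep1mP.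
case: (PP 'X_[m - U_(i)] 'X_i); first by rewrite -mpolyXD mE.
  case/IHk; last first.
    by move=> j; rewrite mnmBE => mj Pj; exists j => //; lia.
  by move: (congr1 mdeg mE) mk; rewrite mdegD mdeg1; lia.
by exists i.
Qed.

Lemma Ass_quot_same I J P :
  same_ideal I J -> Ass_quot I P -> Ass_quot J P.
Proof.
by move=> IJ [Pp [f fP]]; split=> //; exists f => g; rewrite fP IJ.
Qed.

Variable T : pred 'X_{1..n}.
Hypothesis T_up : forall m k : 'X_{1..n}, T m -> T (m + k)%MM.

(** An associated prime (I : f) is also (I : m f) for every monomial m with
    m f outside I, by primality; so f may be taken stable, and then (I : f) is
    the colon ideal of any of its surviving terms. *)
Lemma Ass_mono_idealP P :
  Ass_quot (mono_ideal T) P <->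
  exists w A, (forall m, T (m + w)%MM = meets A m) /\ same_ideal P (var_ideal A).
Proof.
split=> [[Pp [f fP]]|[w [A [wA PA]]]]; last first.
  split; first exact: same_ideal_prime (var_ideal_prime A).
  exists 'X_[w] => g; rewrite PA var_idealP mulrC mono_idealMX.
  by split=> H m /H; rewrite -wA addmC.
have [[P0 PD PM] P1 PP] := Pp.
have nIf : ~ mono_ideal T f by move=> If; apply/P1/fP; rewrite mul1r.
have [m0 nIh hS] := exists_stable T_up nIf.
set h := 'X_[m0] * f in nIh hS.
have hP g : P g <-> mono_ideal T (g * h).
  rewrite /h mulrA -fP; split=> [Pg|/PP[//|Pm]]; first by rewrite mulrC; apply: PM.
  by case: nIh; apply/fP.
have [w wh nTw] : exists2 w, w \in msupp h & ~~ T w.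
  apply: NNPP => H; apply: nIh => w wh; apply: contraT => nTw.
  by case: H; exists w.
have PX m : P 'X_[m] <-> T (m + w)%MM.
  by rewrite hP; split=> [/mono_idealMX/(_ w wh)//|]; apply: hS.
pose A i := T (U_(i) + w)%MM.
have mA m : T (m + w)%MM = meets A m.
  apply/idP/existsP=> [/PX/(prime_monomial _ Pp)[i mi /PX Ai]|[i /andP[Ai mi]]].
    by exists i; rewrite mi andbT.
  by apply/PX/(prime_monomial _ Pp); exists i => //; apply/PX.
exists w, A; split=> // g; rewrite var_idealP; split=> [Pg m mg|Ag].
  by rewrite -mA -PX hP; apply: stable_colon hS _ mg; rewrite -?hP.
rewrite [g]mpolyE; apply: is_ideal_sum => // m /Ag; rewrite -mA -PX => Pm.
by rewrite -mul_mpolyC; apply: PM.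
Qed.

(** The sum of the variables lies in the maximal ideal, so in depth 0 it is a
    zero divisor: it kills some g outside I, which may be taken stable. By
    [stable_colon] each variable kills g, hence any surviving term of g. *)
Lemma depth0_socle I :
    same_ideal I (mono_ideal T) -> ~~ T 0%MM -> is_depth_quot I 0 ->
  exists2 w, ~~ T w & forall i, T (U_(i) + w)%MM.
Proof.
move=> IT T0 [_ dI].
pose f : {mpoly K[n]} := \sum_i 'X_i.
have fm : mono_ideal (meets predT) f.
  apply: is_ideal_sum => [|i _]; first exact/mono_ideal_is_ideal/meets_up.
  by apply/mono_idealX; rewrite meetsU.
apply: NNPP => nS; suff : (size [:: f] <= 0)%N by [].
apply: dI; split=> [g|].
  by rewrite inE => /eqP->; apply/var_idealP.
have mT : forall m, T m -> m != 0%MM by move=> m Tm; apply: contraNneq T0 => <-.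
split=> [[|//] _ g J /=|].
  have JI h : J h <-> mono_ideal T h.
    rewrite -IT; split=> [[a [b [Ia [s [Gs ->]] ->]]]|Ih].
      case: s Gs => [|p s Gs]; first by rewrite big_nil addr0.
      by have := Gs p (mem_head _ _); rewrite take0.
    exists h, 0; split; rewrite ?addr0 //.
    by exists [::]; rewrite big_nil.
  rewrite !JI => Ifg; apply: NNPP => nIg.
  have [m nIh hS] := exists_stable T_up nIg.
  have [w wh nTw] : exists2 w, w \in msupp ('X_[m] * g) & ~~ T w.
    apply: NNPP => H; apply: nIh => w wh; apply: contraT => nTw.
    by case: H; exists w.
  case: nS; exists w => // i.
  have : mono_ideal T ('X_i * ('X_[m] * g)).
    apply: (stable_colon T_up hS (g := f)).
      by rewrite mulrCA; apply: mono_idealM.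
    rewrite mcoeff_msupp raddf_sum (bigD1 i) //= big1.
      by rewrite mcoeffXU eqxx addr0 oner_neq0.
    by move=> j /negPf ji; rewrite mcoeffXU ji.
  by move/mono_idealMX; apply.
move=> [a [b [/IT Ia Gb]]] E.
have : mono_ideal (meets predT) (a + b).
  apply: mono_idealD.
    move=> m /Ia/mT m0; apply: contraT => /existsPn/= H.
    case/eqP: m0; apply/mnmP => i; rewrite mnm0E.
    by apply/eqP/negbNE/H.
  case: Gb => s [Gs ->]; apply: is_ideal_sum.
    exact/mono_ideal_is_ideal/meets_up.
  move=> p /Gs; rewrite inE => /eqP->.
  by apply: mono_idealM => //; exact: meets_up.
by rewrite -E -mpolyX0 mono_idealX; apply/negP/meets0.
Qed.

End AssociatedPrimes.

(** * The lexicographic order on monomials *)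

Lemma seqlexi_ltP (s t : seqlexi nat) : size s = size t ->
  (s < t)%O <-> exists i, [/\ (i < size s)%N,
     forall k, (k < i)%N -> nth 0%N s k = nth 0%N t k
     & (nth 0%N s i < nth 0%N t i)%N].
Proof.
elim: s t => [|x s IHs] [|y t] //=; first by split=> // -[i []].
case=> /IHs {}IHs; rewrite ltxi_cons; case: (ltngtP x y) => [xy|yx|<-{y}].
- rewrite leEnat (ltnW xy) leqNgt xy /=; split=> // _.
  by exists 0%N.
- rewrite leEnat leqNgt yx /=; split=> // -[[|i] [_ lts lti]] /=.
    by rewrite /= ltnNge ltnW in lti.
  by have /= E := lts 0%N isT; rewrite E ltnn in yx.
- rewrite lexx /= IHs; split=> -[]; last move=> [|i] [/= si lts lti].
  + by move=> i [si lts lti]; exists i.+1; split=> // -[|k] // /lts.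
  + by rewrite ltnn in lti.
  + by exists i; split=> // k ki; have := lts k.+1 ki.
Qed.

Section Lex.

Variable n : nat.
Implicit Types (u v w m : 'X_{1..n}) (i j k : 'I_n).

Lemma lex_geNP u v :
  ~~ lex_ge u v <->
  exists i, (forall k, (k < i)%N -> u k = v k) /\ (u i < v i)%N.
Proof.
rewrite /lex_ge -ltNge seqlexi_ltP ?size_tuple //; split.
  move=> [i [ni ltu lti]]; exists (Ordinal ni).
  by split=> [k ki|]; rewrite !(mnm_nth 0%N) //; apply: ltu.
move=> [i [ltu lti]]; exists i; split=> // [k ki|]; rewrite -?mnm_nth //.
by have := ltu (Ordinal (ltn_trans ki (ltn_ord i))) ki; rewrite !(mnm_nth 0%N).
Qed.

Lemma lex_ge_refl u : lex_ge u u.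
Proof. exact: lexx. Qed.

Lemma lex_ge_trans v u w : lex_ge u v -> lex_ge v w -> lex_ge u w.
Proof. by move=> uv vw; exact: le_trans vw uv. Qed.

Lemma lex_geNW u v : ~~ lex_ge u v -> lex_ge v u.
Proof. by rewrite /lex_ge -ltNge; exact: ltW. Qed.

Lemma lex_ge_at i u v :
  (forall k, (k < i)%N -> u k = v k) -> (v i < u i)%N -> lex_ge u v.
Proof.
move=> uv lti; apply: lex_geNW; apply/lex_geNP; exists i.
by split=> // k /uv.
Qed.

Lemma lex_geD w u v : lex_ge (w + u) (w + v) = lex_ge u v.
Proof.
apply: negb_inj; apply/(sameP idP)/(iffP idP)=> /lex_geNP[i [uv lti]];
  apply/lex_geNP; exists i.
  by split=> [k /uv|]; rewrite !mnmDE; lia.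
split=> [k /uv|]; first by rewrite !mnmDE; lia.
by move: lti; rewrite !mnmDE; lia.
Qed.

Lemma lex_geU i j m : (i <= j)%N -> lex_ge (U_(i) + m) (U_(j) + m).
Proof.
rewrite leq_eqVlt => /orP[/eqP/val_inj->|ij]; first exact: lex_ge_refl.
have neq (a b : 'I_n) : (a < b)%N -> (b == a) = false.
  by rewrite -val_eqE /=; lia.
apply: (@lex_ge_at i) => [k ki|]; rewrite !mnmDE !mnm1E.
  by rewrite (neq k i ki) (neq k j (ltn_trans ki ij)).
by rewrite eqxx (neq i j ij).
Qed.

Lemma lex_lt_below i u v :
  (forall k, (k < i)%N -> (u k <= v k)%N) -> (u i < v i)%N -> ~~ lex_ge u v.
Proof.
move=> uv lti; apply/lex_geNP.
have [j ltj minj] := @arg_minnP _ i (fun k => u k < v k)%N val lti.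
exists j; split=> // k kj; apply/eqP; rewrite eqn_leq.
have nk : ~~ (u k < v k)%N by apply/negP => /minj/=; lia.
by rewrite [(v k <= _)%N]leqNgt nk andbT uv // (leq_trans kj) //; exact: minj.
Qed.

Lemma mnm_le_mdeg_eq m w : (m <= w)%MM -> (mdeg w <= mdeg m)%N -> m = w.
Proof.
move=> mw degw; have := submK mw => E.
have /eqP : mdeg (w - m) == 0%N by move: (congr1 mdeg E); rewrite mdegD; lia.
by move/eqP; rewrite mdeg_eq0 => /eqP z; rewrite -E z add0m.
Qed.

(** For a generator m of a monomial ideal, w outside the ideal and x_i w inside,
    this extracts the factor x_i of m. *)
Lemma lepm_addUN i m w :
    (m <= U_(i) + w)%MM -> ~~ (m <= w)%MM ->
  exists2 m', m = (U_(i) + m')%MM & (m' <= w)%MM /\ m' i = w i.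
Proof.
move=> /mnm_lepP miw nmw.
have mi : m i = (w i).+1.
  move: (miw i); rewrite mnmDE mnm1E eqxx leq_eqVlt => /predU1P[//|lti].
  case/negP: nmw; apply/mnm_lepP => k; have := miw k.
  by rewrite mnmDE mnm1E; case: (i =P k) => [<-|]; lia.
exists (m - U_(i))%MM.
  by rewrite addmC submK // lep1mP mi.
split; last by rewrite mnmBE mnm1E eqxx mi; lia.
by apply/mnm_lepP => k; have := miw k; rewrite mnmBE mnmDE; lia.
Qed.

Lemma lepm_addU i m w : (m <= w)%MM -> (U_(i) + m <= U_(i) + w)%MM.
Proof.
by move=> /mnm_lepP mw; apply/mnm_lepP => k; rewrite !mnmDE leq_add2l.
Qed.

Lemma meetsUn (A : pred 'I_n) i (e : nat) : meets A (U_(i) *+ e)%MM -> A i.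
Proof.
move=> /existsP[j /andP[Aj]]; rewrite mulmnE mnm1E.
by case: (i =P j) => [->|_] //; rewrite mul0n.
Qed.

End Lex.

Lemma lex_ge_head n (u v : 'X_{1..n.+1}) :
  lex_ge u v -> (v ord0 <= u ord0)%N.
Proof. by apply: contraTT; rewrite -ltnNge => lt0; apply: (@lex_lt_below _ ord0). Qed.

Lemma lex_ge_of_head n (u v : 'X_{1..n.+1}) :
  (v ord0 < u ord0)%N -> lex_ge u v.
Proof. by move=> lt0; apply: (@lex_ge_at _ ord0). Qed.

Lemma mnm_eq_butlast n (u v : 'X_{1..n.+1}) :
  mdeg u = mdeg v -> (forall k : 'I_n.+1, (k < n)%N -> u k = v k) -> u = v.
Proof.
move=> deg uv; move: deg; rewrite !mdegE (bigD1 ord_max) //= [RHS](bigD1 ord_max) //=.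
have -> : (\sum_(i < n.+1 | i != ord_max) u i
    = \sum_(i < n.+1 | i != ord_max) v i)%N.
  apply: eq_bigr => i; rewrite -val_eqE /= => ni.
  by apply: uv; have := ltn_ord i; lia.
move=> /addIn deg; apply/mnmP => k; have [->|nk] //:= eqVneq k ord_max.
by apply: uv; have := ltn_ord k; move: nk; rewrite -val_eqE /=; lia.
Qed.

(** Among the monomials of a given degree divisible by x_0, the smallest one is
    x_0 times a power of the last variable. *)
Lemma lex_ge_last n (u : 'X_{1..n.+1}) e :
    (0 < u ord0)%N -> mdeg u = e.+1 ->
  lex_ge u (U_(ord0) + U_(ord_max) *+ e).
Proof.
move=> u0 degu; apply: contraT => nge; have /lex_geNP[i [uv lti]] := nge.
have im : i = ord_max.
  apply/eqP; move: lti; rewrite mnmDE mulmnE !mnm1E.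
  case: (ord_max =P i) => [-> //|_].
  by case: (ord0 =P i) => [<-|_]; lia.
suff E : u = (U_(ord0) + U_(ord_max) *+ e)%MM by rewrite -E lex_ge_refl in nge.
apply: mnm_eq_butlast => [|k kn]; last by apply: uv; rewrite im.
by rewrite mdegD mdegMn !mdeg1 degu; lia.
Qed.

(** * Monomials of a lexsegment ideal *)

Section Lexsegment.

Variables (n d : nat) (u v : 'X_{1..n.+1}).
Implicit Types (w m t y z : 'X_{1..n.+1}) (i j k : 'I_n.+1).

Definition in_lexseg m : bool :=
  [exists w : 'X_{1..n.+1 < d.+1}, lexsegment d u v w && (w <= m)%MM].

Lemma in_lexsegP m :
  reflect (exists2 w, lexsegment d u v w & (w <= m)%MM) (in_lexseg m).
Proof.
apply: (iffP existsP) => [[w /andP[Lw wm]]|[w Lw wm]]; first by exists w.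
have dw : (mdeg w < d.+1)%N by case/and3P: Lw => /eqP->.
by exists (BMultinom dw); rewrite Lw.
Qed.

Lemma in_lexseg_trans m t : (m <= t)%MM -> in_lexseg m -> in_lexseg t.
Proof.
move=> mt /in_lexsegP[w Lw wm]; apply/in_lexsegP.
by exists w => //; exact: lepm_trans wm mt.
Qed.

Lemma in_lexseg_up m t : in_lexseg m -> in_lexseg (m + t)%MM.
Proof. exact/in_lexseg_trans/lem_addr. Qed.

Lemma in_lexseg_above w i : ~~ in_lexseg w -> in_lexseg (U_(i) + w)%MM ->
  exists2 y, lexsegment d u v (U_(i) + y)%MM & (y <= w)%MM /\ y i = w i.
Proof.
move=> nTw /in_lexsegP[y Ly yw].
have [|y' E y'w] := lepm_addUN yw; last by exists y' => //; rewrite -E.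
by apply: contra nTw => yw'; apply/in_lexsegP; exists y.
Qed.

Lemma lexseg_idealP (K : fieldType) :
  same_ideal (@lexseg_ideal K _ d u v) (mono_ideal in_lexseg).
Proof.
apply: gen_ideal_monomials => [|m]; first exact: in_lexseg_up.
exact: iff_sym (rwP (in_lexsegP m)).
Qed.

Hypotheses (hd : (2 <= d)%N) (hv : mdeg v = d) (v0 : v ord0 = 0%N).

Lemma lexseg_n_gt0 : (0 < n)%N.
Proof.
rewrite lt0n; apply/eqP => n0; move: hv; rewrite mdegE big1; first by lia.
move=> i _; rewrite -v0; congr (v _); apply: val_inj => /=.
by have := ltn_ord i; lia.
Qed.

Lemma mnm_ord0_max : (U_(ord_max) : 'X_{1..n.+1})%MM ord0 = 0%N.
Proof.
by rewrite mnm1E -val_eqE /=; have := lexseg_n_gt0; case: n.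
Qed.

Section Socle.

Variable w : 'X_{1..n.+1}.
Hypotheses (nTw : ~~ in_lexseg w) (Tw : forall i, in_lexseg (U_(i) + w)%MM).

Lemma socle_u0 : (0 < u ord0)%N.
Proof.
have [y /and3P[_ /lex_ge_head uy _] _] := in_lexseg_above nTw (Tw ord0).
by apply: leq_trans uy; rewrite mnmDE mnm1E eqxx.
Qed.

(** Otherwise u is exactly divisible by x_0 once, and w is not divisible by x_0.
    Generators x_0 y of x_0 w and x_n z of x_n w then satisfy y < z, while y and
    z divide w and have the same degree. So z is a proper divisor of w, and a
    divisor x_j z of w is at least x_n z >= v, which puts w in the ideal. *)
Lemma socle_lex_ge : lex_ge (U_(ord_max) + u) (U_(ord0) + v).
Proof.
apply: contraT => nge; have u0 := socle_u0.
have u01 : u ord0 = 1%N.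
  have := lex_ge_head (lex_geNW nge).
  by rewrite !mnmDE mnm_ord0_max v0 mnm1E eqxx; lia.
have [y /and3P[/eqP degy uy _] [yw y0]] := in_lexseg_above nTw (Tw ord0).
have [z /and3P[/eqP degz _ zv] [zw _]] := in_lexseg_above nTw (Tw ord_max).
have w0 : w ord0 = 0%N.
  by have := lex_ge_head uy; rewrite mnmDE mnm1E eqxx u01 y0; lia.
have nyz : ~~ lex_ge y z.
  apply: contra nge => yz.
  apply: lex_ge_trans (_ : lex_ge _ (U_(ord_max) + (U_(ord0) + y))) _.
    by rewrite lex_geD.
  apply: lex_ge_trans (_ : lex_ge _ (U_(ord0) + (U_(ord_max) + z))) _.
    by rewrite addmA [(U_(ord_max) + _)%MM]addmC -addmA !lex_geD.
  by rewrite lex_geD.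
rewrite !mdegD !mdeg1 in degy degz.
case/boolP: (w <= z)%MM => [wz|].
  case/negP: nyz; suff -> : y = z by exact: lex_ge_refl.
  have Ez : z = w by apply/mnmP=> k; apply/eqP; rewrite eqn_leq !(mnm_lepP _ k).
  by rewrite Ez; apply: mnm_le_mdeg_eq yw _; rewrite -Ez; lia.
move=> /forallPn[j]; rewrite -ltnNge => zj.
case/negP: nTw; apply/in_lexsegP; exists (U_(j) + z)%MM; last first.
  apply/mnm_lepP => k; rewrite mnmDE mnm1E; have := mnm_lepP zw k.
  by case: (j =P k) => [<-|]; lia.
have j0 : (0 < j)%N.
  rewrite lt0n; apply/eqP => j0; move: zj.
  by have -> : j = ord0 by [apply: val_inj]; rewrite w0.
apply/and3P; split.
- by rewrite mdegD mdeg1; lia.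
- apply: lex_ge_of_head; rewrite mnmDE mnm1E -val_eqE /=.
  by have := mnm_lepP zw ord0; rewrite w0; case: (val j) j0 => //=; lia.
- by apply: lex_ge_trans zv; apply: lex_geU; rewrite -ltnS.
Qed.

End Socle.

Hypotheses (hu : mdeg u = d) (u0 : (0 < u ord0)%N).

Lemma lexsegment_no0 t :
  mdeg t = d -> t ord0 = 0%N -> lex_ge t v -> lexsegment d u v t.
Proof.
move=> degt t0 tv; rewrite /lexsegment degt eqxx tv andbT.
by apply: lex_ge_of_head; rewrite t0.
Qed.

Lemma lexsegment_with0 t :
  mdeg t = d -> (0 < t ord0)%N -> lex_ge u t -> lexsegment d u v t.
Proof.
move=> degt t0 ut; rewrite /lexsegment degt eqxx ut.
by apply: lex_ge_of_head; rewrite v0.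
Qed.

Lemma lexsegment_0last : lexsegment d u v (U_(ord0) + U_(ord_max) *+ d.-1)%MM.
Proof.
apply: lexsegment_with0.
- by rewrite mdegD mdegMn !mdeg1; lia.
- by rewrite mnmDE mnm1E eqxx.
- by apply: lex_ge_last; rewrite // hu prednK //; lia.
Qed.

Lemma mnm1_ord0 i : (0 < i)%N -> (U_(i) : 'X_{1..n.+1})%MM ord0 = 0%N.
Proof. by move=> i0; rewrite mnm1E -val_eqE /=; case: (val i) i0. Qed.

(** The equality of ideals (I : w) = (x_i, i in A). Both sides are monomial
    ideals, so comparing their monomials is enough. *)
Definition colon_is w (A : pred 'I_n.+1) :=
  forall m, in_lexseg (m + w)%MM = meets A m.

(** To compute a colon ideal generated by variables, it is enough to test
    membership of those variables. *)
Lemma colon_isP w (A : pred 'I_n.+1) :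
    (forall m, ~~ meets A m -> ~~ in_lexseg (m + w)%MM) ->
    (forall i, A i -> in_lexseg (U_(i) + w)%MM) ->
  colon_is w A.
Proof.
move=> nA TA m; apply/idP/idP; first by apply: contraTT; exact: nA.
move=> /existsP[i /andP[Ai mi]].
by rewrite -(@submK _ U_(i)%MM m) ?lep1mP // -addmA addmC; apply/in_lexseg_up/TA.
Qed.

Lemma meetsN (A : pred 'I_n.+1) m i : ~~ meets A m -> A i -> m i = 0%N.
Proof. by move=> /existsPn/(_ i) + Ai; rewrite Ai /= => /negbNE/eqP. Qed.

(** The factor v / x_j makes x_i w reach x_i v / x_j >= v for 0 < i <= j, while
    variables after x_j cannot repair the deficit at j. The factor x_n^(d-1) is
    there for i = 0: it makes x_0 w a multiple of x_0 x_n^(d-1), the smallest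
    monomial of degree d divisible by x_0. *)
Lemma colon_supp j : (j < n)%N -> (0 < v j)%N ->
  exists w, colon_is w (fun i => i <= j)%N.
Proof.
move=> jn vj.
have j0 : (0 < j)%N.
  rewrite lt0n; apply/eqP => j0; move: vj.
  by have -> : j = ord0 by [apply: val_inj]; rewrite v0.
have vE : (U_(j) + (v - U_(j)) = v)%MM by rewrite addmC submK // lep1mP -lt0n.
exists (v - U_(j) + U_(ord_max) *+ d.-1)%MM; apply: colon_isP => [m nm|i ij].
  apply/in_lexsegP => -[t /and3P[_ _ tv] /mnm_lepP tm]; move: tv; apply/negP.
  have tle k : (k <= j)%N -> (t k <= v k - (j == k))%N.
    move=> kj; have := tm k; rewrite !mnmDE mnmBE mulmnE !mnm1E.
    by rewrite (meetsN nm kj) -[ord_max == k]val_eqE /=; lia.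
  apply: (@lex_lt_below _ j) => [k kj|]; last first.
    by have := tle j (leqnn j); rewrite eqxx; lia.
  by have := tle k (ltnW kj); lia.
apply/in_lexsegP; have [i0|i0] := posnP i.
  have -> : i = ord0 by apply: val_inj.
  exists (U_(ord0) + U_(ord_max) *+ d.-1)%MM; first exact: lexsegment_0last.
  exact/lepm_addU/lem_addl.
exists (U_(i) + (v - U_(j)))%MM; last exact/lepm_addU/lem_addr.
apply: lexsegment_no0.
- by move: (congr1 mdeg vE); rewrite !mdegD !mdeg1 hv.
- by rewrite mnmDE mnmBE v0 mnm1_ord0.
- by rewrite -{2}vE; apply: lex_geU.
Qed.

(** The part of v in x_0, ..., x_i divides w with a factor x_i to spare;
    multiplying it by that x_i already beats v, and padding by the last variable
    reaches degree d. *)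
Lemma colon_prefix w i :
    (0 < i)%N -> (i < n)%N ->
    (forall k, (k < i)%N -> (v k <= w k)%N) -> (v i < w i)%N ->
  in_lexseg (U_(ord_max) *+ d + w)%MM.
Proof.
move=> i0 ilt vw lti; apply/in_lexsegP.
pose r : 'X_{1..n.+1} := [multinom (if (k <= i)%N then v k else 0%N) | k < n.+1].
have rE k : r k = if (k <= i)%N then v k else 0%N by rewrite mnmE.
have rv : (r <= v)%MM by apply/mnm_lepP => k; rewrite rE; case: ifP.
have rw k : (k <= i)%N -> (r k <= w k)%N.
  rewrite rE => ki; rewrite ki; move: ki; rewrite leq_eqVlt => /predU1P[/val_inj->|/vw//].
  exact: ltnW.
have [rd|rd] := leqP d (mdeg r).
  (* The part of v up to x_i already has degree d, so v itself divides w. *)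
  have E : r = v by apply: mnm_le_mdeg_eq rv _; rewrite hv.
  exists v; last first.
    apply/mnm_lepP => k; rewrite mnmDE -E.
    have [/rw|ik] := leqP k i; first by lia.
    by rewrite rE [(k <= i)%N]leqNgt ik.
  by apply: lexsegment_no0 => //; exact: lex_ge_refl.
have dr : mdeg (U_(i) + (r + U_(ord_max) *+ (d.-1 - mdeg r)))%MM = d.
  by rewrite !mdegD mdegMn !mdeg1; lia.
exists (U_(i) + (r + U_(ord_max) *+ (d.-1 - mdeg r)))%MM; last first.
  apply/mnm_lepP => k; rewrite !mnmDE !mulmnE.
  have [|ik] := leqP k i.
    rewrite leq_eqVlt => /predU1P[/val_inj->|ki].
      by rewrite mnm1E eqxx rE leqnn; nia.
    have := rw k (ltnW ki); have -> : (U_(i) : 'X_{1..n.+1})%MM k = 0%N.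
      by rewrite mnm1E -val_eqE /=; lia.
    by nia.
  have -> : (U_(i) : 'X_{1..n.+1})%MM k = 0%N by rewrite mnm1E -val_eqE /=; lia.
  by rewrite rE [(k <= i)%N]leqNgt ik /=; nia.
have max0 k : (k <= i)%N -> (U_(ord_max) : 'X_{1..n.+1})%MM k = 0%N.
  by move=> ki; rewrite mnm1E -val_eqE /=; lia.
apply: lexsegment_no0 => //.
  by rewrite !mnmDE mulmnE rE v0 mnm1_ord0 // max0.
apply: (@lex_ge_at _ i) => [k ki|]; rewrite !mnmDE mulmnE rE max0 ?(ltnW ki) //.
  by rewrite mnm1E -val_eqE /=; lia.
by rewrite leqnn mnm1E eqxx; lia.
Qed.

Hypothesis uv_ge : lex_ge (U_(ord_max) + u) (U_(ord0) + v).

(** If x_j^d < v, then x_0 x_j^(d-1) <= u: the opposite would give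
    x_0 x_j^d >= x_n (x_0 x_j^(d-1)) >= x_n u >= x_0 v. *)
Lemma in_lexseg_0pow j : (0 < j)%N -> in_lexseg (U_(ord0) + U_(j) *+ d)%MM.
Proof.
move=> j0; apply/in_lexsegP.
have jd : (U_(j) *+ d = U_(j) + U_(j) *+ d.-1)%MM by rewrite -mulmS prednK //; lia.
have [jv|njv] := boolP (lex_ge (U_(j) *+ d)%MM v).
  exists (U_(j) *+ d)%MM; last exact: lem_addl.
  apply: lexsegment_no0 => //; first by rewrite mdegMn mdeg1 mul1n.
  by rewrite mulmnE mnm1_ord0.
pose t : 'X_{1..n.+1} := (U_(ord0) + U_(j) *+ d.-1)%MM.
exists t; last by rewrite jd; apply/lepm_addU/lem_addl.
apply: lexsegment_with0.
- by rewrite mdegD mdegMn !mdeg1; lia.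
- by rewrite mnmDE mnm1E eqxx.
apply: contraNT njv => /lex_geNW tu; rewrite -(lex_geD U_(ord0)%MM).
apply: lex_ge_trans uv_ge; apply: lex_ge_trans (_ : lex_ge _ (U_(ord_max) + t)) _.
  rewrite jd addmA [(U_(ord0) + _)%MM]addmC -addmA.
  by apply: lex_geU; rewrite -ltnS.
by rewrite lex_geD.
Qed.

(** Let a be the exponent of x_0 in u, and p = x_0^a x_1^(d-a) the largest
    monomial of degree d with that exponent. If u < p, take w = p: its multiples
    by powers of x_0 have no divisor of degree d that is at most u, while
    x_i w / x_0 is below u, and above v since
    x_i p >= x_n p >= x_n u >= x_0 v. If u = p, take w = p / x_1, so that
    x_i w <= x_1 w = u. *)
Lemma colon_no0 : (u ord0 < d)%N -> exists w, colon_is w (fun i => 0 < i)%N.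
Proof.
move=> u0d; have n0 := lexseg_n_gt0.
pose o1 : 'I_n.+1 := inord 1; have o1E : o1 = 1%N :> nat by rewrite inordK.
have o01 : (ord0 == o1) = false by rewrite -val_eqE /= o1E.
pose p a b : 'X_{1..n.+1} := (U_(ord0) *+ a + U_(o1) *+ b)%MM.
have p0 a b : p a b ord0 = a.
  by rewrite mnmDE !mulmnE !mnm1E eqxx eq_sym o01; lia.
have p1 a b : p a b o1 = b.
  by rewrite mnmDE !mulmnE !mnm1E eqxx o01; lia.
have p2 a b k : (1 < k)%N -> p a b k = 0%N.
  move=> k1; rewrite mnmDE !mulmnE !mnm1E -!val_eqE /= o1E.
  by case: (val k) k1 => [|[]].
have degp a b : mdeg (p a b) = (a + b)%N by rewrite mdegD !mdegMn !mdeg1 !mul1n.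
have pS a b : p a b.+1 = (U_(o1) + p a b)%MM.
  by rewrite /p mulmS addmA [(_ + U_(o1))%MM]addmC -addmA.
have p_le m : (p (m ord0) (m o1) <= m)%MM.
  apply/mnm_lepP => k; have [k1|] := leqP k 1; last by move/p2->.
  have [k0|k0] := posnP k.
    by have -> : k = ord0 by [apply: val_inj]; rewrite p0.
  have -> : k = o1 by apply: val_inj; rewrite /= o1E; lia.
  by rewrite p1.
have deg_ge m : (m ord0 + m o1 <= mdeg m)%N.
  by have := congr1 mdeg (submK (p_le m)); rewrite mdegD degp; lia.
have a0 := u0; set a := u ord0 in u0d a0.
(* The exponent of x_1 in u equals d - a exactly when u = x_0^a x_1^(d-a). *)
pose e := if u o1 == (d - a)%N then (d - a).-1 else (d - a)%N.
have ude := deg_ge u; rewrite hu -/a in ude.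
exists (p a e); apply: colon_isP => [m nm|i i0].
  apply/in_lexsegP => -[t /and3P[/eqP degt ut _] /mnm_lepP tm].
  have te k : (0 < k)%N -> (t k <= p a e k)%N.
    by move=> k0; have := tm k; rewrite mnmDE (meetsN nm k0).
  have tE : t = p (t ord0) (t o1).
    apply/mnmP => k; have [k1|k1] := leqP k 1; last first.
      by rewrite p2 //; have := te k (ltnW k1); rewrite p2 //; lia.
    have [k0|k0] := posnP k.
      by have -> : k = ord0 by [apply: val_inj]; rewrite p0.
    have -> : k = o1 by apply: val_inj; rewrite /= o1E; lia.
    by rewrite p1.
  have t0 := lex_ge_head ut; rewrite -/a in t0.
  have t1 : (t o1 <= e)%N by have := te o1; rewrite p1 o1E; apply.
  move: (degt); rewrite tE degp => degt'.
  move: ut; apply/negP; move: t1; rewrite /e; case: eqP => [|ne] t1; first by lia.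
  apply: (@lex_lt_below _ o1) => [k|]; last by lia.
  rewrite o1E ltnS leqn0 => /eqP k0.
  by have -> : k = ord0 by [apply: val_inj]; rewrite -/a; lia.
apply/in_lexsegP; have [ud|/negPf ud] := eqVneq (u o1) (d - a)%N.
  have eE : e = (d - a).-1 by rewrite /e ud eqxx.
  have uE : (U_(o1) + p a e)%MM = u.
    rewrite -pS eE prednK; last by lia.
    apply: mnm_le_mdeg_eq; last by rewrite degp hu; lia.
    by rewrite -ud; exact: p_le.
  exists (U_(i) + p a e)%MM; last exact: lepm_refl.
  apply: lexsegment_with0.
  - by rewrite mdegD mdeg1 degp eE; lia.
  - by rewrite mnmDE p0; lia.
  - by rewrite -{1}uE; apply: lex_geU; rewrite o1E.
have eE : e = (d - a)%N by rewrite /e ud.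
pose t : 'X_{1..n.+1} := (U_(i) + p a.-1 e)%MM.
have tE : (U_(ord0) + t = U_(i) + p a e)%MM.
  rewrite addmA [(U_(ord0) + U_(i))%MM]addmC -addmA; congr (_ + _)%MM.
  by rewrite /p addmA -mulmS prednK.
exists t; last by rewrite -tE; exact: lem_addl.
have degt : mdeg t = d by rewrite mdegD mdeg1 degp; lia.
rewrite /lexsegment degt eqxx /=; apply/andP; split.
  by apply: lex_ge_of_head; rewrite mnmDE mnm1_ord0 // p0 -/a; lia.
rewrite -(lex_geD U_(ord0)%MM) tE; apply: lex_ge_trans uv_ge.
apply: lex_ge_trans (_ : lex_ge _ (U_(ord_max) + p a e)%MM) _.
  by apply: lex_geU; rewrite -ltnS.
rewrite lex_geD; apply: (@lex_ge_at _ o1) => [k|]; last by rewrite p1; lia.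
rewrite o1E ltnS leqn0 => /eqP k0.
by have -> : k = ord0 by [apply: val_inj]; rewrite p0.
Qed.

(** The case split is on whether x_0 and x_n belong to A. If x_0 does not, the
    monomials x_0 x_j^d of the ideal put every other variable in A. If both do,
    dividing x_0 w or x_n w by x_0 or x_n and multiplying by x_i stays in the
    ideal. If only x_0 does, the first position where w differs from v is the
    last variable of A. *)
Lemma colon_cases w (A : pred 'I_n.+1) : colon_is w A ->
  (exists2 j : 'I_n.+1, (j == ord_max) || (0 < v j)%N & A =1 (fun i => i <= j)%N)
  \/ A =1 (fun i => 0 < i)%N.
Proof.
move=> wA.
have nTw : ~~ in_lexseg w by rewrite -[w]add0m wA meets0.
have AU i : A i = in_lexseg (U_(i) + w)%MM by rewrite wA meetsU.
have [A0|nA0] := boolP (A ord0); last first.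
  right=> i; have [i0|i0] := posnP i.
    by have -> : i = ord0 by [apply: val_inj]; exact: negbTE.
  have := in_lexseg_up w (in_lexseg_0pow i0).
  by rewrite wA meetsD meetsU (negbTE nA0) => /= /meetsUn.
left; have [An|nAn] := boolP (A ord_max).
  exists ord_max; rewrite ?eqxx // => i.
  rewrite -ltnS ltn_ord AU; have [i0|i0] := posnP i.
    by have -> : i = ord0 by [apply: val_inj]; rewrite -AU.
  have TA j : A j -> in_lexseg (U_(j) + w)%MM by rewrite AU.
  have [y Ly [yw y0]] := in_lexseg_above nTw (TA _ A0).
  have [z Lz [zw _]] := in_lexseg_above nTw (TA _ An).
  have [w0|w0] := posnP (w ord0).
    apply/in_lexsegP; exists (U_(i) + z)%MM; last exact: lepm_addU.
    have /and3P[/eqP degz _ zv] := Lz; rewrite !mdegD !mdeg1 in degz.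
    apply: lexsegment_no0.
    - by rewrite mdegD mdeg1.
    - by rewrite mnmDE mnm1_ord0 //; have := mnm_lepP zw ord0; lia.
    - by apply: lex_ge_trans zv; apply: lex_geU; rewrite -ltnS.
  apply/in_lexsegP; exists (U_(i) + y)%MM; last exact: lepm_addU.
  have /and3P[/eqP degy uy _] := Ly; rewrite !mdegD !mdeg1 in degy.
  apply: lexsegment_with0.
  - by rewrite mdegD mdeg1.
  - by rewrite mnmDE y0; lia.
  - by apply: lex_ge_trans uy _; apply: lex_geU.
(* From here on x_n is not in A: no power of x_n brings w into the ideal. *)
have nTn (k : nat) : ~~ in_lexseg (U_(ord_max) *+ k + w)%MM.
  by rewrite wA; apply: contra nAn; exact: meetsUn.
have w0 : w ord0 = 0%N.
  apply/eqP; apply: contraNeq (nTn d.-1) => w0; apply/in_lexsegP.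
  exists (U_(ord0) + U_(ord_max) *+ d.-1)%MM; first exact: lexsegment_0last.
  apply/mnm_lepP => k; rewrite !mnmDE addnC leq_add2l.
  by rewrite mnm1E; case: (ord0 =P k) => [<-|]; lia.
have [i0 wi0] : exists i : 'I_n.+1, (i < n)%N && (w i != v i).
  apply/existsP; apply: contraNT (nTn d) => /existsPn wv.
  apply/in_lexsegP; exists v; first by apply: lexsegment_no0 => //; exact: lex_ge_refl.
  apply/mnm_lepP => k; rewrite mnmDE mulmnE mnm1E.
  have vd : (v k <= d)%N by rewrite -hv mdegE (bigD1 k) //= leq_addr.
  case: (ord_max =P k) => [_|nk]; first by lia.
  have /nandP[] := wv k; last by move=> /negbNE/eqP->; lia.
  by case/negP; rewrite ltn_neqAle -ltnS ltn_ord andbT; apply/eqP => kn;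
    apply: nk; apply: val_inj.
have [j /andP[jn wvj] minj] :=
  @arg_minnP _ i0 (fun i => (i < n) && (w i != v i))%N val wi0.
have wv k : (k < j)%N -> w k = v k.
  move=> kj; apply/eqP; apply: contraTT kj => wvk; rewrite -leqNgt.
  have [kn|kn] := ltnP k n; first by apply: minj; rewrite kn.
  exact: leq_trans (ltnW jn) kn.
have j0 : (0 < j)%N.
  rewrite lt0n; apply/eqP => j0; move: wvj.
  by have -> : j = ord0 by [apply: val_inj]; rewrite w0 v0.
have ltwv : (w j < v j)%N.
  rewrite ltn_neqAle wvj leqNgt; apply/negP => vwj.
  case/negP: (nTn d); apply: (@colon_prefix _ j) => // k kj.
  by rewrite wv.
exists j; first by rewrite (leq_ltn_trans _ ltwv) // orbT.
move=> i; apply/idP/idP => [|ij].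
  rewrite AU; apply: contraTT; rewrite -ltnNge => ji.
  apply/in_lexsegP => -[t /and3P[_ _ tv] /mnm_lepP tw]; move: tv; apply/negP.
  have tle k : (k <= j)%N -> (t k <= w k)%N.
    by move=> kj; have := tw k; rewrite mnmDE mnm1E -val_eqE /=; lia.
  apply: (@lex_lt_below _ j) => [k kj|].
    by rewrite -wv // tle // ltnW.
  by apply: leq_ltn_trans ltwv; exact: tle.
have [i1|i1] := posnP i; first by have -> : i = ord0 by [apply: val_inj].
have : in_lexseg (U_(ord_max) *+ d + (U_(i) *+ d.+1 + w))%MM.
  apply: (@colon_prefix _ i) => //; first exact: leq_ltn_trans ij jn.
    by move=> k ki; rewrite mnmDE wv ?leq_addl // (leq_trans ki).
  have vd : (v i <= d)%N by rewrite -hv mdegE (bigD1 i) //= leq_addr.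
  by rewrite mnmDE mulmnE mnm1E eqxx; lia.
by rewrite addmA wA meetsD => /orP[/meetsUn|/meetsUn //]; rewrite (negbTE nAn).
Qed.

End Lexsegment.

(** * Associated primes *)

Theorem proposition2p4 (K : fieldType) (n d : nat) (u v : 'X_{1..n.+1})
    (hd : (2 <= d)%N) (hu : mdeg u = d) (hv : mdeg v = d) (huv : lex_ge u v)
    (hninit : ~ initial_lexseg d (lexseg_ideal K d u v))
    (hnfin : ~ final_lexseg d (lexseg_ideal K d u v))
    (hx1 : ~~ (U_(ord0) <= v)%MM)
    (hdepth : is_depth_quot (lexseg_ideal K d u v) 0) :
  forall P : {mpoly K[n.+1]} -> Prop,
    Ass_quot (lexseg_ideal K d u v) P <->
    (exists2 j : 'I_n.+1, j \in mnm_supp v :|: [set ord_max]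
       & same_ideal P (var_ideal (fun i => (i <= j)%N)))
    \/ same_ideal P (var_ideal (fun i => (0 < i)%N)).
Proof.
move=> P.
have v0 : v ord0 = 0%N by apply/eqP; rewrite -[_ == _]negbK -lep1mP.
have T0 : ~~ in_lexseg d u v 0%MM.
  apply/in_lexsegP => -[w /and3P[/eqP degw _ _] w0].
  have E := mnm_le_mdeg_eq w0; rewrite mdeg0 in E.
  by move: degw; rewrite E // mdeg0; lia.
have up := @in_lexseg_up n d u v.
have IT := @lexseg_idealP n d u v K.
have [w nTw Tw] := depth0_socle up IT T0 hdepth.
have u0 := socle_u0 nTw Tw.
have uv_ge := socle_lex_ge hd hv v0 nTw Tw.
have u0d : (u ord0 < d)%N.
  rewrite ltnNge; apply/negP => du; apply: hninit; exists v; split=> //.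
  suff <- : (U_(ord0) *+ d)%MM = u by [].
  apply: mnm_le_mdeg_eq; last by rewrite mdegMn mdeg1 hu mul1n.
  apply/mnm_lepP => k; rewrite mulmnE mnm1E.
  by case: (ord0 =P k) => [<-|_]; rewrite ?mul1n.
have AssE : Ass_quot (lexseg_ideal K d u v) P
    <-> exists w A, colon_is d u v w A /\ same_ideal P (var_ideal A).
  rewrite -(Ass_mono_idealP up); split; apply: Ass_quot_same => // f.
  by rewrite IT.
have extA (A B : pred 'I_n.+1) :
    A =1 B -> same_ideal P (var_ideal A) -> same_ideal P (var_ideal B).
  move=> AB PA f; rewrite PA !var_idealP /mono_ideal.
  by split=> H m /H; rewrite /meets; [under eq_existsb => i do rewrite AB
    | under eq_existsb => i do rewrite -AB].
rewrite AssE; split=> [[z [A [zA PA]]]|].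
  have [[j jv AE]|AE] := colon_cases hd hv v0 hu u0 uv_ge zA.
    left; exists j; last exact: extA PA.
    by rewrite !inE lep1mP -lt0n orbC.
  by right; exact: extA PA.
case=> [[j jv PA]|PA]; last first.
  have [z zA] := colon_no0 hd hv v0 hu u0 uv_ge u0d.
  by exists z, (fun i => 0 < i)%N.
have [jn|jn] := ltnP j n.
  have vj : (0 < v j)%N.
    move: jv; rewrite !inE lep1mP -lt0n => /orP[//|/eqP E].
    by rewrite E ltnn in jn.
  have [z zA] := colon_supp hd hv v0 hu u0 jn vj.
  by exists z, (fun i => i <= j)%N.
exists w, (fun i : 'I_n.+1 => i <= j)%N; split=> //; apply: colon_isP => // m nm.
suff -> : m = 0%MM by rewrite add0m.
apply/mnmP => i; rewrite mnm0E; apply: (meetsN nm).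
by rewrite (leq_trans _ jn) // -ltnS.
Qed.
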